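(* There exists a unique self-orthogonal $2$-$(16,6,8)$ design $D$ up to isomorphism, and $D$ generates the near-extremal Type I $[16,8,4]$ code.
   Context: A $t$-$(v,k,\lambda)$ design is a pair $(X,\mathcal{B})$, where $X$ is a set of points of cardinality $v$ and $\mathcal{B}$ is a collection of $k$-element subsets of $X$, called blocks, with the property that any $t$ points are contained in precisely $\lambda$ blocks. A $t$-design is called self-orthogonal if the block intersection numbers have the same parity as the block size $k$. Two designs are isomorphic if there is a bijection between their point sets carrying the collection of blocks of one to the collection of blocks of the other. Codes are binary linear codes; an $[n,k,d]$ code has length $n$, dimension $k$ and minimum distance $d$. The code generated by a design is the binary code spanned by the rows of a block-point incidence matrix of the design (rows indexed by blocks, columns by points, with entry $1$ if the point lies in the block and $0$ otherwise). A Type I code is a binary code that is self-dual with respect to $(x,y)=\sum_i x_iy_i$ and is not doubly even, i.e. not all of its weights are divisible by $4$. A Type I code of length $n$ is near-extremal if its minimum distance is $d=2\lfloor n/8\rfloor$. It is known that the Type I $[16,8,4]$ code is unique (up to equivalence, i.e. permutation of coordinates). *)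

(* Defs.v *)
From HB Require Import structures.
From mathcomp Require Import all_boot all_order all_algebra.

Set Implicit Arguments.
Unset Strict Implicit.
Unset Printing Implicit Defensive.

Import GRing.Theory.
Local Open Scope ring_scope.

(* A design is a finite type X of points with a set B of blocks; since B is a
   set of sets, there are no repeated blocks. With repeated blocks allowed,
   four copies of a 2-(16,6,2) biplane would also be a self-orthogonal
   2-(16,6,8) design, and uniqueness would fail. *)
Definition is_design (t v k lambda : nat) (X : finType) (B : {set {set X}}) :=
  [/\ #|X| = v,
      forall b : {set X}, b \in B -> #|b| = k
    & forall A : {set X}, #|A| = t ->
        #|[set b in B | A \subset b]| = lambda].

Definition self_orthogonal (k : nat) (X : finType) (B : {set {set X}}) :=
  forall b c : {set X}, b \in B -> c \in B -> b != c ->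
    odd #|b :&: c| = odd k.

Definition isomorphic (X Y : finType) (B : {set {set X}}) (C : {set {set Y}}) :=
  exists2 f : X -> Y, bijective f & [set f @: (b : {set X}) | b in B] = C.

Definition incidence_mx (X : finType) (B : {set {set X}}) :
    'M['F_2]_(#|B|, #|X|) :=
  \matrix_(i, j) (enum_val j \in (enum_val i : {set X}))%:R.

Definition design_code (X : finType) (B : {set {set X}}) :
    {vspace 'rV['F_2]_#|X|} :=
  <<[seq row i (incidence_mx B) | i : 'I_#|B|]>>%VS.

Section Codes.

Variable n : nat.
Implicit Types (C : {vspace 'rV['F_2]_n}) (x y : 'rV['F_2]_n).

Definition weight x : nat := #|[set i | x 0 i != 0]|.

Definition hamming_dist x y : nat := #|[set i | x 0 i != y 0 i]|.

Definition dot x y : 'F_2 := \sum_i x 0 i * y 0 i.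

Definition is_min_dist C (d : nat) :=
  (exists x y, [/\ x \in C, y \in C, x != y & hamming_dist x y = d]) /\
  (forall x y, x \in C -> y \in C -> x != y -> (d <= hamming_dist x y)%N).

(* The length is an explicit argument because the ambient length of
   design_code B is #|X|, which is only propositionally equal to it. *)
Definition is_code C (len k d : nat) :=
  [/\ n = len, \dim C = k & is_min_dist C d].

Definition self_dual C :=
  forall x, x \in C <-> (forall y, y \in C -> dot x y = 0).

Definition doubly_even C := forall x, x \in C -> (4 %| weight x)%N.

Definition typeI C := self_dual C /\ ~ doubly_even C.

Definition near_extremal C := typeI C /\ is_min_dist C (2 * (n %/ 8))%N.

End Codes.

(* Main.v *)
Require Import Defs.
From mathcomp Require Import all_boot all_order all_algebra.
From mathcomp Require Import finfield zify.

Set Implicit Arguments.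
Unset Strict Implicit.
Unset Printing Implicit Defensive.

Import GRing.Theory.

(** Points and blocks of a self-orthogonal 2-(16,6,8) design are best seen inside
    the binary code that the blocks generate.  Counting gives 24 blocks through
    each point and 64 blocks in all.

    Maximality.  A family of n pairwise orthogonal 6-subsets of a 16-set gives,
    together with the complements, 2n words of weight 2 mod 4 in a self-orthogonal
    code; translating by one block yields 2n words of weight 0 mod 4.  The code
    has at most 2^8 words, so n <= 64 (card_orth_family).  Hence the blocks are
    all the 6-sets that meet every block evenly (block_maximal).

    Words of weight 4.  Consider the 4-sets that meet every block evenly.  No
    2-set does (no_orth_pair), so such a word meets a block in 0 or 2 points and
    its sum with a block that it meets is again a block, by maximality.  Counting
    the blocks that meet a given block in 4 points then shows that each point
    lies on exactly three words (card_star_words).  The three words through a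
    point share a second point, since otherwise their sum would be a fourth
    (card_meet3_words).  The points therefore split into two sides of four
    columns of size two, the words being the unions of two columns of one side
    (side_through, side_closed, two_sides).

    Uniqueness.  A block through a whole column meets each column of the other
    side once (block_transversal).  One such block for each side labels the
    points of the columns by bits (coordinates), which identifies the points with
    those of a model.  Every model block is obtained from these two blocks by
    adding words (model_generated), so it goes to a 6-set that meets every block
    evenly, that is, to a block (model_unique).

    The code.  For the model, the all-one word is a sum of four blocks, and the
    same count of words shows that the code has at least 2^8 words.  It is then
    self-dual, since it is maximal among self-orthogonal codes; its weights are
    even, different from 2 by no_orth_pair, and 4 occurs. *)

(** * Subsets as binary words *)

Section SubsetAlgebra.

Variable T : finType.
Implicit Types A B C : {set T}.

Definition symdiff A B := [set x | (x \in A) (+) (x \in B)].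

Definition orth A B := ~~ odd #|A :&: B|.

Lemma orthC A B : orth A B = orth B A.
Proof. by rewrite /orth setIC. Qed.

Lemma card_symdiff A B : #|symdiff A B| + 2 * #|A :&: B| = #|A| + #|B|.
Proof.
have -> : symdiff A B = (A :\: B) :|: (B :\: A).
  by apply/setP=> x; rewrite !inE; case: (x \in A); case: (x \in B).
rewrite cardsU.
have -> : (A :\: B) :&: (B :\: A) = set0.
  by apply/setP=> x; rewrite !inE; case: (x \in A); case: (x \in B).
have := cardsID B A; have := cardsID A B; rewrite cards0 (setIC B A).
lia.
Qed.

Lemma symdiffI A B C : symdiff A B :&: C = symdiff (A :&: C) (B :&: C).
Proof. by apply/setP=> x; rewrite !inE; case: (x \in C); rewrite ?andbT ?andbF. Qed.

Lemma odd_symdiff A B : odd #|symdiff A B| = odd #|A| (+) odd #|B|.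
Proof.
by rewrite -oddD -(card_symdiff A B) oddD mul2n odd_double addbF.
Qed.

Lemma orth_symdiff A B C : orth A C -> orth B C -> orth (symdiff A B) C.
Proof.
by rewrite /orth symdiffI odd_symdiff => /negPf-> /negPf->.
Qed.

Lemma symdiffK A : involutive (symdiff A).
Proof. by move=> B; apply/setP=> x; rewrite !inE addbA addbb. Qed.

Lemma symdiff_inj A : injective (symdiff A).
Proof. exact: inv_inj (symdiffK A). Qed.

Lemma orth_setT A : orth [set: T] A = ~~ odd #|A|.
Proof. by rewrite /orth setTI. Qed.

End SubsetAlgebra.

Section CharacteristicVectors.

Variable T : finType.
Implicit Types A B : {set T}.

Local Open Scope ring_scope.

Lemma natr_F2 n : n%:R = (odd n)%:R :> 'F_2.
Proof. by rewrite -modn2 (GRing.natr_mod_pchar (pchar_Fp _)). Qed.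

Lemma F2_cases (a : 'F_2) : a = (a != 0)%:R.
Proof. by apply/val_inj; case: a => [[|[|[]]]]. Qed.

Definition char_vec A : 'rV['F_2]_#|T| := \row_j (enum_val j \in A)%:R.

Definition support (x : 'rV['F_2]_#|T|) : {set T} :=
  [set t | x 0 (enum_rank t) != 0].

Lemma supportK : cancel support char_vec.
Proof.
by move=> x; apply/rowP=> j; rewrite !mxE inE enum_valK -F2_cases.
Qed.

Lemma char_vecK : cancel char_vec support.
Proof.
move=> A; apply/setP=> t; rewrite inE mxE enum_rankK.
by case: (t \in A); rewrite ?oner_eq0 ?eqxx.
Qed.

Lemma char_vec_symdiff A B :
  char_vec (symdiff A B) = char_vec A + char_vec B.
Proof.
apply/rowP=> j; rewrite !mxE inE.
by case: (_ \in A); case: (_ \in B); apply/val_inj.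
Qed.

Lemma weight_char_vec A : weight (char_vec A) = #|A|.
Proof.
rewrite -[A in RHS]char_vecK /weight /support.
rewrite -[RHS](card_imset _ enum_rank_inj); apply: eq_card => j.
apply/idP/imsetP => [|[t]]; rewrite !inE => nz; last by move->.
by exists (enum_val j); rewrite ?inE enum_valK.
Qed.

Lemma dot_char_vec A B : dot (char_vec A) (char_vec B) = (#|A :&: B|)%:R.
Proof.
rewrite -(weight_char_vec (A :&: B)) /weight /dot -sum1_card natr_sum.
rewrite [RHS]big_mkcond /=; apply: eq_bigr => j _.
rewrite !inE !mxE inE.
by case: (_ \in A); case: (_ \in B); rewrite ?mulr0 ?mul0r ?mulr1 ?oner_eq0 ?eqxx.
Qed.

Lemma dot_char_vec0 A B : dot (char_vec A) (char_vec B) = 0 <-> orth A B.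
Proof.
rewrite dot_char_vec natr_F2 /orth.
by case: (odd _); split=> // /eqP; rewrite ?oner_eq0.
Qed.

Lemma hamming_char_vec A B :
  hamming_dist (char_vec A) (char_vec B) = #|symdiff A B|.
Proof.
rewrite -weight_char_vec; apply: eq_card => j; rewrite !inE !mxE inE.
by case: (_ \in A); case: (_ \in B).
Qed.

End CharacteristicVectors.

Section SelfOrthogonalCodes.

Local Open Scope ring_scope.

Lemma dotC n (x y : 'rV['F_2]_n) : dot x y = dot y x.
Proof. by apply: eq_bigr => i _; rewrite mulrC. Qed.

Lemma dotDl n (x y z : 'rV['F_2]_n) : dot (x + y) z = dot x z + dot y z.
Proof. by rewrite -big_split; apply: eq_bigr => i _; rewrite mxE mulrDl. Qed.

Lemma dotZl n a (x y : 'rV['F_2]_n) : dot (a *: x) y = a * dot x y.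
Proof. by rewrite /dot mulr_sumr; apply: eq_bigr => i _; rewrite mxE mulrA. Qed.

Lemma dot_span n (s : seq 'rV['F_2]_n) (y : 'rV_n) :
    (forall x, x \in s -> dot x y = 0) ->
  forall x, x \in <<s>>%VS -> dot x y = 0.
Proof.
move=> s0 x xs; have {xs} -> := @coord_span _ _ _ (in_tuple s) x xs.
apply: (big_ind (fun z => dot z y = 0)).
- by rewrite /dot big1 // => i _; rewrite mxE mul0r.
- by move=> u v u0 v0; rewrite dotDl u0 v0 addr0.
- by move=> i _; rewrite dotZl s0 ?mulr0 // mem_nth.
Qed.

Lemma dot_span2 n (s : seq 'rV['F_2]_n) :
    {in s &, forall x y, dot x y = 0} ->
  {in <<s>>%VS &, forall x y, dot x y = 0}.
Proof.
move=> s0 x y xs ys; apply: dot_span xs => {}x xs.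
by rewrite dotC; apply: dot_span ys => {}y ys; apply: s0.
Qed.

(** A basis matrix M of the code satisfies M *m M^T = 0, so twice its rank is
    at most the length. *)
Lemma dim_self_orthogonal n (V : {vspace 'rV['F_2]_n}) :
  {in V &, forall x y, dot x y = 0} -> (2 * \dim V <= n)%N.
Proof.
move=> V0; pose M := \matrix_(i < \dim V) (vbasis V)`_i.
have rM : \rank M = \dim V.
  apply/eqP; rewrite -[_ == _]/(row_free M); apply: inj_row_free => v.
  rewrite mulmx_sum_row => vM0; apply/rowP=> i; rewrite mxE.
  have /freeP free := basis_free (vbasisP V).
  apply: (free (v 0)); rewrite -[RHS]vM0.
  by apply: eq_bigr => k _; rewrite rowK.
have MM0 : M *m M^T = 0.
  apply/matrixP=> i j; rewrite !mxE -[RHS](V0 (vbasis V)`_i (vbasis V)`_j).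
  - by apply: eq_bigr => k _; rewrite !mxE.
  - by rewrite vbasis_mem // mem_nth // size_tuple.
  - by rewrite vbasis_mem // mem_nth // size_tuple.
by have := mulmx0_rank_max MM0; rewrite mxrank_tr rM mul2n -addnn.
Qed.

Lemma card_code n (V : {vspace 'rV['F_2]_n}) : #|V| = (2 ^ \dim V)%N.
Proof. by rewrite card_vspace card_Fp. Qed.

End SelfOrthogonalCodes.

(** * Orthogonal families of 6-subsets of a 16-set *)

Section OrthogonalFamilies.

Variable T : finType.
Hypothesis cardT : #|T| = 16.
Variable F : {set {set T}}.
Hypothesis cardF : forall A, A \in F -> #|A| = 6.
Hypothesis orthF : {in F &, forall A B, orth A B}.

(** The members of F and their complements are words of weight 2 mod 4;
    translating them by a member of F gives as many words of weight 0 mod 4. *)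
Lemma leq_card_orth_family (V : {vspace 'rV['F_2]_#|T|}) :
    char_vec [set: T] \in V -> (forall A, A \in F -> char_vec A \in V) ->
  4 * #|F| <= #|V|.
Proof.
move=> VT VF; have [->|[B FB]] := set_0Vmem F; first by rewrite cards0.
have cardC A : A \in F -> #|symdiff [set: T] A| = 10.
  move=> FA; have := card_symdiff [set: T] A.
  rewrite setTI cardsT cardT (cardF FA); lia.
pose S := F :|: symdiff [set: T] @: F; pose S' := symdiff B @: S.
have SV A : A \in S -> char_vec A \in V.
  case/setUP=> [/VF//|/imsetP[A' FA' ->]].
  by rewrite char_vec_symdiff memvD // VF.
have orthS A : A \in S -> orth A B.
  case/setUP=> [FA|/imsetP[A' FA' ->]]; first exact: orthF.
  apply: orth_symdiff; last exact: orthF.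
  by rewrite orth_setT cardF.
have wS A : A \in S -> #|A| = 6 \/ #|A| = 10.
  case/setUP=> [FA|/imsetP[A' FA' ->]]; first by rewrite cardF //; left.
  by rewrite cardC //; right.
have cardS : #|S| = 2 * #|F|.
  rewrite cardsU (card_imset _ (@symdiff_inj _ _)).
  suff -> : F :&: symdiff [set: T] @: F = set0 by rewrite cards0 subn0 addnn mul2n.
  apply/setP=> A; rewrite !inE; apply/andP=> -[FA /imsetP[A' FA' defA]].
  by have := cardF FA; rewrite defA cardC.
have SS' : S :&: S' = set0.
  apply/setP=> A; rewrite !inE -in_setU; apply/andP=> -[SA /imsetP[A' SA' defA]].
  have := card_symdiff B A'; rewrite -defA (cardF FB).
  have := orthS _ SA'; rewrite orthC /orth.
  by have [|] := wS _ SA; have [|] := wS _ SA'; lia.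
have -> : 4 * #|F| = #|@char_vec T @: (S :|: S')|.
  rewrite (card_imset _ (can_inj (@char_vecK T))) cardsU SS' cards0 subn0.
  by rewrite (card_imset _ (@symdiff_inj _ _)) cardS addnn -mul2n mulnA.
apply: subset_leq_card; apply/subsetP=> _ /imsetP[A + ->].
case/setUP=> [/SV//|/imsetP[A' SA' ->]].
by rewrite char_vec_symdiff; apply: memvD; [apply: VF | apply: SV].
Qed.

(** The span of F and the all-one word is self-orthogonal, so it has at most
    2 ^ 8 words. *)
Lemma card_orth_family : #|F| <= 64.
Proof.
pose s := char_vec [set: T] :: [seq char_vec A | A <- enum F].
have s0 : {in s &, forall x y, dot x y = 0%R}.
  have sP x : x \in s -> exists2 A, x = char_vec A & A = [set: T] \/ A \in F.
    rewrite inE => /predU1P[->|/mapP[A]]; first by exists [set: T]; [|left].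
    by rewrite mem_enum => FA ->; exists A; [|right].
  have oT A : A \in F -> orth [set: T] A by move=> FA; rewrite orth_setT cardF.
  move=> _ _ /sP[A -> FA] /sP[B -> FB]; apply/dot_char_vec0.
  case: FA FB => [->|FA] [->|FB].
  - by rewrite orth_setT cardsT cardT.
  - exact: oT.
  - by rewrite orthC oT.
  - exact: orthF.
have dim8 : \dim <<s>> <= 8.
  rewrite -(leq_pmul2l (isT : 0 < 2)).
  by apply: leq_trans (dim_self_orthogonal (dot_span2 s0)) _; rewrite cardT.
rewrite -(leq_pmul2l (isT : 0 < 4)); apply: (@leq_trans #|<<s>>%VS|).
  apply: leq_card_orth_family => [|A FA]; apply: memv_span.
    exact: mem_head.
  by rewrite inE map_f ?orbT // mem_enum.
by rewrite card_code (leq_exp2l _ 8).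
Qed.

End OrthogonalFamilies.

Lemma orth_family_maximal (T : finType) (F : {set {set T}}) (C : {set T}) :
    #|T| = 16 -> (forall A, A \in F -> #|A| = 6) ->
    {in F &, forall A B, orth A B} -> #|F| = 64 ->
  #|C| = 6 -> (forall A, A \in F -> orth C A) -> C \in F.
Proof.
move=> cardT cardF orthF F64 C6 orthC_F; apply: contraT => FC.
suff: #|C |: F| <= 64 by rewrite cardsU1 FC F64.
apply: card_orth_family => // [A|A B] => [/setU1P[->|/cardF]//|].
case/setU1P=> [->|FA] /setU1P[->|FB].
- by rewrite /orth setIid C6.
- exact: orthC_F.
- by rewrite orthC orthC_F.
- exact: orthF.
Qed.

(** * Counting in a self-orthogonal 2-(16,6,8) design *)

Lemma sum_setId (T : finType) (A : {set T}) (P : pred T) (f : T -> nat) :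
  \sum_(x in [set x in A | P x]) f x = \sum_(x in A) P x * f x.
Proof.
rewrite big_mkcond [RHS]big_mkcond; apply: eq_bigr => x _; rewrite inE.
by case: (x \in A); case: (P x); rewrite ?mul1n.
Qed.

Lemma card_setId (T : finType) (A : {set T}) (P : pred T) :
  #|[set x in A | P x]| = \sum_(x in A) P x.
Proof. by rewrite -sum1_card sum_setId; apply: eq_bigr => x _; rewrite muln1. Qed.

Lemma card_setI (T : finType) (A B : {set T}) :
  #|A :&: B| = \sum_(x in A) (x \in B).
Proof. by rewrite -card_setId; apply: eq_card => x; rewrite !inE. Qed.

Definition star (T : finType) (F : {set {set T}}) x := [set b in F | x \in b].

Lemma sum_card_meet (T : finType) (F : {set {set T}}) (A : {set T}) :
  \sum_(b in F) #|A :&: b| = \sum_(y in A) #|star F y|.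
Proof.
rewrite (eq_bigr _ (fun b _ => card_setI A b)) exchange_big /=.
by apply: eq_bigr => y _; rewrite card_setId.
Qed.

Section Counting.

Variables (T : finType) (D : {set {set T}}).
Hypothesis desD : is_design 2 16 6 8 D.

Let cardT : #|T| = 16. Proof. by case: desD. Qed.
Let cardD b : b \in D -> #|b| = 6. Proof. by case: desD => _ + _; apply. Qed.

Lemma card_star2 x y : x != y -> #|star (star D x) y| = 8.
Proof.
move=> xy; case: desD => _ _ /(_ [set x; y]); rewrite cards2 xy => /(_ erefl) <-.
by apply: eq_card => b; rewrite !inE subUset !sub1set andbA.
Qed.

Lemma sum_star_meet x (A : {set T}) : x \in A ->
  \sum_(b in star D x) #|A :&: b| = #|star D x| + 8 * #|A|.-1.
Proof.
move=> xA; rewrite sum_card_meet (big_setD1 x) //=; congr (_ + _).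
  by apply: eq_card => b; rewrite !inE -andbA andbb.
rewrite (eq_bigr (fun=> 8)) => [|y]; last first.
  by rewrite !inE eq_sym => /andP[xy _]; apply: card_star2.
by rewrite sum_nat_const mulnC (cardsD1 x A) xA.
Qed.

Lemma card_star x : #|star D x| = 24.
Proof.
have := sum_star_meet (in_setT x); rewrite cardsT cardT.
rewrite (eq_bigr (fun=> 6)) => [|b]; last by rewrite setTI inE => /andP[/cardD].
rewrite sum_nat_const; lia.
Qed.

Lemma card_blocks : #|D| = 64.
Proof.
have := sum_card_meet D [set: T].
rewrite (eq_bigr (fun=> 6)) => [|b]; last by rewrite setTI => /cardD.
rewrite [in RHS](eq_bigr (fun=> 24)) => [|y _]; last exact: card_star.
rewrite !sum_nat_const cardsT cardT; lia.
Qed.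

Lemma block_through x : exists2 b, b \in D & x \in b.
Proof.
have: 0 < #|star D x| by rewrite card_star.
by case/card_gt0P=> b; rewrite inE => /andP[]; exists b.
Qed.

Section FixedBlock.

Variable B : {set T}.
Hypothesis DB : B \in D.

Lemma sum_meet_block : \sum_(b in D) #|B :&: b| = 144.
Proof.
rewrite sum_card_meet (eq_bigr (fun=> 24)) => [|y _]; last exact: card_star.
by rewrite sum_nat_const cardD.
Qed.

Lemma sum_star_meet_block x : x \in B -> \sum_(b in star D x) #|B :&: b| = 64.
Proof. by move=> xB; rewrite sum_star_meet // card_star cardD. Qed.

Lemma sum_sqr_meet_block : \sum_(b in D) #|B :&: b| * #|B :&: b| = 384.
Proof.
rewrite (eq_bigr (fun b : {set T} => \sum_(y in B) (y \in b) * #|B :&: b|));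
  last first.
  by move=> b _; rewrite -big_distrl -card_setI.
rewrite exchange_big /= (eq_bigr (fun=> 64)); first by rewrite sum_nat_const cardD.
by move=> x xB; rewrite -(sum_star_meet_block xB) sum_setId.
Qed.

End FixedBlock.

Hypothesis soD : self_orthogonal 6 D.

Lemma orth_blocks : {in D &, forall b c, orth b c}.
Proof.
move=> b c Db Dc; have [->|bc] := eqVneq b c; first by rewrite /orth setIid cardD.
by rewrite /orth soD.
Qed.

Lemma block_maximal (C : {set T}) :
  #|C| = 6 -> {in D, forall b, orth C b} -> C \in D.
Proof.
exact: (orth_family_maximal cardT cardD orth_blocks card_blocks).
Qed.

Lemma meet_block_cases B b : B \in D -> b \in D ->
  [\/ b = B, #|B :&: b| = 0, #|B :&: b| = 2 | #|B :&: b| = 4].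
Proof.
move=> DB Db; have [->|bB] := eqVneq b B; first by constructor 1.
have := orth_blocks DB Db; have := subset_leq_card (subsetIl B b).
have: #|B :&: b| != 6.
  apply: contra bB => /eqP c6; have/eqP E1: B :&: b == B.
    by rewrite eqEcard subsetIl c6 cardD.
  by rewrite eq_sym eqEcard -[in X in X && _]E1 subsetIr !cardD.
rewrite /orth (cardD DB); move: #|_| => [|[|[|[|[|[|[|n]]]]]]] // _ _ _.
- by constructor 2.
- by constructor 3.
- by constructor 4.
Qed.

(** For i in {0, 2, 4}, i ^ 2 = 2 i + 8 [i = 4]; B itself contributes
    36 = 2 * 6 + 24. *)
Lemma card_meet4 B : B \in D -> #|[set b in D | #|B :&: b| == 4]| = 9.
Proof.
move=> DB; have cB := cardD DB.
have E b : b \in D -> #|B :&: b| * #|B :&: b| =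
    2 * #|B :&: b| + 8 * (#|B :&: b| == 4) + 24 * (b == B).
  move=> Db; have [->|bB] := eqVneq b B; first by rewrite setIid cB.
  by have [bB'|->|->|->] := meet_block_cases DB Db; first by rewrite bB' eqxx in bB.
have := sum_sqr_meet_block DB; rewrite (eq_bigr _ E) 2!big_split /=.
rewrite -!big_distrr /= sum_meet_block // -!card_setId.
suff -> : [set b in D | b == B] = [set B].
  by rewrite cards1; move: #|_| => n; lia.
by apply/setP=> b; rewrite !inE; case: eqP => [->|]; rewrite ?DB ?andbF.
Qed.

(** Through x the possible sizes are 2, 4 and, for B itself, 6, so the size is
    2 + 2 [i = 4] + 4 [b = B]. *)
Lemma card_star_meet4 B x : B \in D -> x \in B ->
  #|[set b in star D x | #|B :&: b| == 4]| = 6.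
Proof.
move=> DB xB; have cB := cardD DB.
have E b : b \in star D x ->
    #|B :&: b| = 2 + 2 * (#|B :&: b| == 4) + 4 * (b == B).
  rewrite inE => /andP[Db xb].
  have [->|bB] := eqVneq b B; first by rewrite setIid cB.
  have [bB'|c0|->|->] := meet_block_cases DB Db => //.
    by rewrite bB' eqxx in bB.
  by have /setP/(_ x) := cards0_eq c0; rewrite !inE xB xb.
have := sum_star_meet_block DB xB; rewrite (eq_bigr _ E) 2!big_split /=.
rewrite -!big_distrr /= sum_nat_const card_star -!card_setId.
suff -> : [set b in star D x | b == B] = [set B].
  by rewrite cards1; move: #|_| => n; lia.
by apply/setP=> b; rewrite !inE; case: eqP => [->|]; rewrite ?DB ?xB ?andbF.
Qed.

(** * The words of weight 4 orthogonal to all blocks *)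

Definition words4 := [set w : {set T} | (#|w| == 4) && [forall b in D, orth w b]].

Lemma words4P (w : {set T}) :
  reflect (#|w| = 4 /\ {in D, forall b, orth w b}) (w \in words4).
Proof.
rewrite inE; apply: (iffP andP) => [[/eqP c4 /forall_inP ow]|[/eqP c4 ow]] //.
by split=> //; apply/forall_inP.
Qed.

(** If a pair {x, y} met every block evenly, each of the 24 blocks through x
    would contain y, whereas only 8 do. *)
Lemma no_orth_pair (A : {set T}) : {in D, forall b, orth A b} -> #|A| != 2.
Proof.
move=> oA; apply/negP=> /cards2P[x [y [xy defA]]].
have: #|star D x| <= #|star (star D x) y|.
  apply/subset_leq_card/subsetP=> b bx; rewrite inE bx /=.
  move: bx; rewrite inE => /andP[/oA oAb xb]; apply: contraLR oAb => yb.
  rewrite /orth negbK (_ : A :&: b = [set x]) ?cards1 // defA.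
  apply/setP=> z; rewrite !inE.
  have [->|_] := eqVneq z x; first by rewrite xb.
  by have [->|//] := eqVneq z y; rewrite (negPf yb).
by rewrite card_star card_star2.
Qed.

Lemma word_meet_block w b : w \in words4 -> b \in D ->
  #|w :&: b| = 0 \/ #|w :&: b| = 2.
Proof.
move=> /words4P[c4 ow] Db; have := subset_leq_card (subsetIl w b).
have owb := ow b Db.
have n2 : #|symdiff b w| != 2.
  apply: no_orth_pair => c Dc.
  by apply: orth_symdiff; [apply: orth_blocks | apply: ow].
have := card_symdiff b w; rewrite setIC c4 (cardD Db).
move: n2 owb; rewrite /orth; lia.
Qed.

Lemma symdiff_word_block w b : w \in words4 -> b \in D ->
  #|w :&: b| = 2 -> symdiff b w \in D.
Proof.
move=> /words4P[c4 ow] Db c2; apply: block_maximal => [|c Dc].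
  have := card_symdiff b w; rewrite setIC c2 c4 (cardD Db); lia.
by apply: orth_symdiff; [apply: orth_blocks | apply: ow].
Qed.

Lemma word_meets_block w b x : w \in words4 -> b \in D ->
  x \in w -> x \in b -> #|w :&: b| = 2.
Proof.
move=> Ww Db xw xb; have [c0|//] := word_meet_block Ww Db.
by have /setP/(_ x) := cards0_eq c0; rewrite !inE xw xb.
Qed.

(** Adding to a word w a block through one of its points gives a block, so w is a
    sum of two blocks, and v meets both evenly. *)
Lemma orth_words : {in words4 &, forall v w, orth v w}.
Proof.
move=> v w Wv Ww; have [cv ov] := words4P _ Wv.
have: 0 < #|w| by have [->] := words4P _ Ww.
case/card_gt0P=> x xw; have [b Db xb] := block_through x.
have Dbw := symdiff_word_block Ww Db (word_meets_block Ww Db xw xb).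
by rewrite orthC -(symdiffK b w) orth_symdiff // orthC ov.
Qed.

Lemma symdiff_words v w : v \in words4 -> w \in words4 -> #|v :&: w| = 2 ->
  symdiff v w \in words4.
Proof.
move=> /words4P[cv ov] /words4P[cw ow] c2; apply/words4P; split=> [|b Db].
  have := card_symdiff v w; lia.
by apply: orth_symdiff; [apply: ov | apply: ow].
Qed.

(** For a block B through x, w |-> B + w maps the words through x onto the
    blocks that avoid x and meet B in four points: there are 9 - 6 of them. *)
Lemma card_star_words x : #|star words4 x| = 3.
Proof.
have [B DB xB] := block_through x.
pose M := [set b in D | #|B :&: b| == 4].
have -> : #|star words4 x| = #|M :\: star M x|.
  rewrite -(card_imset _ (@symdiff_inj _ B)); apply: eq_card => b.
  apply/imsetP/idP => [[w]|].
    rewrite inE => /andP[Ww xw] ->; have c2 := word_meets_block Ww DB xw xB.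
    rewrite !inE symdiff_word_block // xB xw andbF /=.
    have := card_symdiff B (symdiff B w); rewrite symdiffK.
    have := card_symdiff B w; rewrite setIC c2 (cardD DB).
    by have [-> _] := words4P _ Ww; lia.
  rewrite !inE => /andP[+ /andP[Db c4]]; rewrite Db c4 /= => xb.
  exists (symdiff B b); last by rewrite symdiffK.
  rewrite inE [x \in _]inE xB (negPf xb) andbT; apply/words4P; split=> [|c Dc].
    have := card_symdiff B b; rewrite (eqP c4) (cardD DB) (cardD Db); lia.
  by apply: orth_symdiff; apply: orth_blocks.
rewrite cardsD (card_meet4 DB).
suff -> : M :&: star M x = [set b in star D x | #|B :&: b| == 4].
  by rewrite card_star_meet4.
by apply/setP=> b; rewrite !inE; case: (b \in D); case: (x \in b); case: (_ == _).
Qed.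

End Counting.

(** * The two sides and their columns *)

Lemma sum_bool2 (g : bool * bool -> nat) :
  \sum_c g c =
  g (false, false) + g (false, true) + (g (true, false) + g (true, true)).
Proof.
rewrite (eq_bigr (fun c => g (c.1, c.2))) => [|[] //].
rewrite -(pair_bigA _ (fun a b => g (a, b))) /= !big_bool /=; lia.
Qed.

Section Columns.

Variables (T : finType) (D : {set {set T}}).
Hypothesis desD : is_design 2 16 6 8 D.
Hypothesis soD : self_orthogonal 6 D.

Let cardT : #|T| = 16. Proof. by case: desD. Qed.
Let cardD b : b \in D -> #|b| = 6. Proof. by case: desD => _ + _; apply. Qed.
Let W := words4 D.

(** The side itself is the union of the four columns Q c; the labelling of the
    columns by pairs of bits is arbitrary. *)
Definition is_side (Q : bool * bool -> {set T}) :=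
  [/\ forall c, #|Q c| = 2,
      forall c d, c != d -> Q c :&: Q d = set0
    & forall c d, c != d -> Q c :|: Q d \in W].

Lemma card_meet_words x v w :
  v \in star W x -> w \in star W x -> v != w -> #|v :&: w| = 2.
Proof.
rewrite ![_ \in star _ _]inE => /andP[Wv xv] /andP[Ww xw] vw.
have [[cv _] [cw _]] := (words4P _ _ Wv, words4P _ _ Ww).
have := orth_words desD soD Wv Ww; have := subset_leq_card (subsetIl v w).
have: #|v :&: w| != 4.
  apply: contra vw => /eqP c4; have/eqP E1: v :&: w == v.
    by rewrite eqEcard subsetIl c4 cv.
  by rewrite eqEcard -[in X in X && _]E1 subsetIr cv cw.
have: 0 < #|v :&: w| by apply/card_gt0P; exists x; rewrite inE xv.
by rewrite /orth cv; move: #|_| => n; clear; lia.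
Qed.

(** The sum of the three words through x has weight 4 |v1 :&: v2 :&: v3|.
    Weight 4 would make it a fourth word through x, so the three words share
    two points. *)
Lemma card_meet3_words x v1 v2 v3 : star W x = [set v1; v2; v3] ->
  v1 != v2 -> v1 != v3 -> v2 != v3 -> #|v1 :&: v2 :&: v3| = 2.
Proof.
move=> defW n12 n13 n23.
have [S1 S2 S3] : [/\ v1 \in star W x, v2 \in star W x & v3 \in star W x].
  by rewrite defW !inE !eqxx ?orbT.
have c12 := card_meet_words S1 S2 n12.
have c13 := card_meet_words S1 S3 n13.
have c23 := card_meet_words S2 S3 n23.
have [W1 x1] : v1 \in W /\ x \in v1 by move: S1; rewrite inE => /andP[].
have [W2 x2] : v2 \in W /\ x \in v2 by move: S2; rewrite inE => /andP[].
have [W3 x3] : v3 \in W /\ x \in v3 by move: S3; rewrite inE => /andP[].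
have [c1 _] := words4P _ _ W1; have [c2 _] := words4P _ _ W2.
have [c3 o3] := words4P _ _ W3.
have W12 := symdiff_words desD W1 W2 c12; have [_ o12] := words4P _ _ W12.
pose u := symdiff (symdiff v1 v2) v3.
have cu : #|u| = 4 * #|v1 :&: v2 :&: v3|.
  have := card_symdiff (symdiff v1 v2) v3; rewrite -/u symdiffI.
  have := card_symdiff (v1 :&: v3) (v2 :&: v3).
  have := card_symdiff v1 v2; rewrite c12 c1 c2 c3 c13 c23.
  have -> : v1 :&: v3 :&: (v2 :&: v3) = v1 :&: v2 :&: v3 by rewrite setIACA setIid.
  move: #|u| #|symdiff v1 v2| #|symdiff (v1 :&: v3) _| #|v1 :&: _ :&: _|.
  by clear=> *; lia.
have: 0 < #|v1 :&: v2 :&: v3| by apply/card_gt0P; exists x; rewrite !inE x1 x2.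
have: #|v1 :&: v2 :&: v3| <= 2 by rewrite -c12 subset_leq_card ?subsetIl.
have: #|v1 :&: v2 :&: v3| != 1.
  apply/eqP=> c; rewrite c in cu.
  have: u \in star W x.
    have xu : x \in u by rewrite !inE x1 x2 x3.
    rewrite inE xu andbT; apply/words4P; split=> // b Db.
    by apply: orth_symdiff; [apply: o12 | apply: o3].
  have sym0 (A B : {set T}) : symdiff A B = set0 -> A = B.
    move=> /setP e; apply/setP=> z; have := e z; rewrite !inE.
    by case: (z \in A); case: (z \in B).
  rewrite defW !inE -orbA => /or3P[] /eqP/setP e.
  - case/eqP: n23; apply: sym0; apply/setP=> z; have := e z; rewrite !inE.
    by case: (z \in v1); case: (z \in v2); case: (z \in v3).
  - case/eqP: n13; apply: sym0; apply/setP=> z; have := e z; rewrite !inE.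
    by case: (z \in v1); case: (z \in v2); case: (z \in v3).
  - case/eqP: n12; apply: sym0; apply/setP=> z; have := e z; rewrite !inE.
    by case: (z \in v1); case: (z \in v2); case: (z \in v3).
by move: #|_| => n; clear; lia.
Qed.

Lemma side_through x : exists2 Q, is_side Q & x \in Q (false, false).
Proof.
have [v1 [v2 [v3 [n12 n13 n23 defW]]]] : exists v1 v2 v3,
    [/\ v1 != v2, v1 != v3, v2 != v3 & star W x = [set v1; v2; v3]].
  have := card_star_words desD soD x; rewrite cardE.
  have := enum_uniq (star W x).
  have: star W x = [set w in enum (star W x)].
    by apply/setP=> w; rewrite inE mem_enum.
  case: (enum _) => [|v1 [|v2 [|v3 [|//]]]] //= -> /and3P[] + + _ _.
  rewrite !inE !negb_or => /andP[n12 n13] n23; exists v1, v2, v3; split=> //.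
  by apply/setP=> w; rewrite !inE orbA.
have [S1 S2 S3] : [/\ v1 \in star W x, v2 \in star W x & v3 \in star W x].
  by rewrite defW !inE !eqxx ?orbT.
have c12 := card_meet_words S1 S2 n12.
have c13 := card_meet_words S1 S3 n13.
have c23 := card_meet_words S2 S3 n23.
have c123 := card_meet3_words defW n12 n13 n23.
have [W1 x1] : v1 \in W /\ x \in v1 by move: S1; rewrite inE => /andP[].
have [W2 x2] : v2 \in W /\ x \in v2 by move: S2; rewrite inE => /andP[].
have [W3 x3] : v3 \in W /\ x \in v3 by move: S3; rewrite inE => /andP[].
have [c1 _] := words4P _ _ W1; have [c2 _] := words4P _ _ W2.
have [c3 _] := words4P _ _ W3.
pose m := v1 :&: v2 :&: v3.
have e12 : v1 :&: v2 = m.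
  by apply/esym/eqP; rewrite eqEcard subsetIl c12 c123.
have e13 : v1 :&: v3 = m.
  by apply/esym/eqP; rewrite eqEcard c13 c123 /m setIAC subsetIl.
have e23 : v2 :&: v3 = m.
  by apply/esym/eqP; rewrite eqEcard c23 c123 /m -setIA subsetIr.
have s1 : m \subset v1 by rewrite -e12 subsetIl.
have s2 : m \subset v2 by rewrite -e12 subsetIr.
have s3 : m \subset v3 by rewrite -e13 subsetIr.
pose Q (c : bool * bool) := match c with
  | (false, false) => m | (false, true) => v1 :\: m
  | (true, false) => v2 :\: m | (true, true) => v3 :\: m end.
have UQ (v w : {set T}) :
    v \in W -> w \in W -> v :&: w = m -> (v :\: m) :|: (w :\: m) \in W.
  move=> Wv Ww e; rewrite (_ : _ :|: _ = symdiff v w).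
    by apply: symdiff_words; rewrite // e.
  by rewrite -e; apply/setP=> z; rewrite !inE; case: (z \in v); case: (z \in w).
have Um (v : {set T}) : m \subset v -> m :|: (v :\: m) = v.
  by move=> sv; rewrite -{1}(setIidPr sv) setID.
have IQ (v w : {set T}) : v :&: w = m -> (v :\: m) :&: (w :\: m) = set0.
  by rewrite -setDIl => ->; rewrite setDv.
have Im (v : {set T}) : m :&: (v :\: m) = set0.
  by rewrite setIDA -setIDAC setDv set0I.
exists Q; last by rewrite /= !inE x1 x2.
split.
- case=> [[] []]; rewrite /Q //; rewrite cardsDS // c123.
  + by rewrite c3.
  + by rewrite c2.
  + by rewrite c1.
- by case=> [[] []] [[] []]; rewrite /Q // => _;
  rewrite ?[_ :&: m]setIC ?Im ?IQ // setIC.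
- case=> [[] []] [[] []]; rewrite /Q // => _; rewrite ?[_ :|: m]setUC ?Um //.
  all: by apply: UQ; rewrite // setIC.
Qed.

End Columns.

Section Sides.

Variables (T : finType) (D : {set {set T}}).
Hypothesis desD : is_design 2 16 6 8 D.
Hypothesis soD : self_orthogonal 6 D.

Let cardT : #|T| = 16. Proof. by case: desD. Qed.
Let cardD b : b \in D -> #|b| = 6. Proof. by case: desD => _ + _; apply. Qed.
Let W := words4 D.

(** A point of a side lies on three words made of columns of that side, hence
    on no others. *)
Lemma side_closed Q c z w : is_side D Q -> z \in Q c -> w \in W -> z \in w ->
  exists d, w = Q c :|: Q d.
Proof.
move=> [cQ IQ WQ] zc Ww zw.
pose U := [set Q c :|: Q d | d in [set~ c]].
have sU : U \subset star W z.
  apply/subsetP=> _ /imsetP[d + ->]; rewrite in_setC1 => dc.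
  by rewrite inE in_setU zc andbT WQ // eq_sym.
have cU : #|U| = 3.
  rewrite card_in_imset ?cardsC1 ?card_prod ?card_bool // => d e.
  rewrite !inE => dc ec /setP E; apply: contraTeq (ltn0Sn 1) => de.
  rewrite -(cQ d) -leqNgt leqn0 cards_eq0; apply/eqP/setP=> y; rewrite inE.
  apply/negP=> yd; have := E y; rewrite !inE yd orbT => /esym/orP[yc|ye].
    by have /setP/(_ y) := IQ _ _ dc; rewrite !inE yd yc.
  by have /setP/(_ y) := IQ _ _ de; rewrite !inE yd ye.
have : w \in U.
  suff -> : U = star W z by rewrite inE Ww.
  by apply/eqP; rewrite eqEcard sU cU card_star_words.
by case/imsetP=> d _ ->; exists d.
Qed.

Lemma two_sides : exists Q : bool -> bool * bool -> {set T},
  (forall s, is_side D (Q s)) /\ (forall c d, Q false c :&: Q true d = set0).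
Proof.
have [x _] : exists x : T, x \in [set: T].
  by apply/card_gt0P; rewrite cardsT cardT.
have [Q0 side0 _] := side_through desD soD x.
pose S := \bigcup_c Q0 c.
have [y yS] : exists y, y \notin S.
  apply/existsP; rewrite -[[exists _, _]]negbK negb_exists.
  apply/negP=> /forallP allS.
  have: #|S| <= \sum_c #|Q0 c|.
    by rewrite /S; elim/big_ind2: _ => [|m A n B|//]; rewrite ?cards0 // cardsU; lia.
  have [cQ _ _] := side0; rewrite sum_bool2 !cQ.
  suff -> : S = [set: T] by rewrite cardsT cardT.
  by apply/setP=> y; rewrite inE; have := allS y; rewrite negbK.
have [Q1 side1 y1] := side_through desD soD y.
exists (fun s => if s then Q1 else Q0); split; first by case.
move=> c d; apply/setP=> z; rewrite !inE; apply/negP=> /andP[zc zd].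
have [w [Ww zw yw]] : exists w, [/\ w \in W, z \in w & y \in w].
  have [_ _ WQ] := side1; have [d0|d0] := eqVneq d (false, false).
    exists (Q1 (false, false) :|: Q1 (false, true)).
    by rewrite WQ // !inE y1 -d0 zd.
  by exists (Q1 d :|: Q1 (false, false)); rewrite WQ // !inE y1 zd orbT.
case/negP: yS; have [e defw] := side_closed side0 zc Ww zw.
by move: yw; rewrite defw => /setUP[ye|ye]; apply/bigcupP; [exists c|exists e].
Qed.

Section TwoSides.

Variable Q : bool -> bool * bool -> {set T}.
Hypothesis sideQ : forall s, is_side D (Q s).
Hypothesis disjQ : forall c d, Q false c :&: Q true d = set0.

Lemma columns_disjoint s t c d z : z \in Q s c -> z \in Q t d -> (s, c) = (t, d).
Proof.
move=> zc zd; have [st|st] := eqVneq s t; last first.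
  have [c' [d' [zc' zd']]] : exists c' d', z \in Q false c' /\ z \in Q true d'.
    by case: s t zc zd st => [] [] // zc zd _; [exists d, c | exists c, d].
  by have /setP/(_ z) := disjQ c' d'; rewrite !inE zc' zd'.
rewrite -{t}st in zd *; have [->//|cd] := eqVneq c d.
by have [_ /(_ _ _ cd)/setP/(_ z)] := sideQ s; rewrite !inE zc zd.
Qed.

Lemma sum_columns (B : {set T}) : \sum_s \sum_c #|Q s c :&: B| = #|B|.
Proof.
pose P (i : bool * (bool * bool)) := Q i.1 i.2.
have dP i j : i != j -> [disjoint P i & P j].
  move=> ij; rewrite -setI_eq0; apply/eqP/setP=> z; rewrite !inE.
  apply/negP=> /andP[zi zj]; case/eqP: ij.
  by rewrite [i]surjective_pairing [j]surjective_pairing (columns_disjoint zi zj).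
have sumP (E : T -> nat) := partition_disjoint_bigcup addn E dP.
have PT : \bigcup_i P i = [set: T].
  apply/eqP; rewrite eqEcard subsetT cardsT cardT -sum1_card sumP.
  rewrite (eq_bigr (fun=> 2)) => [|i _]; last first.
    by rewrite sum1_card; have [-> _ _] := sideQ i.1.
  by rewrite sum_nat_const !card_prod card_bool.
rewrite pair_bigA /= -[B in RHS](setTI B) card_setI -PT sumP.
by apply: eq_bigr => i _; rewrite card_setI.
Qed.

(** A block through a whole column misses the other columns of that side, as it
    meets every word of weight 4 in at most two points.  Its other four points
    then lie one in each column of the other side, for the same reason. *)
Lemma block_transversal s k B c : B \in D -> Q (~~ s) k \subset B ->
  #|Q s c :&: B| = 1.
Proof.
move=> DB kB.
have meet t d e : d != e -> #|Q t d :&: B| + #|Q t e :&: B| = 0 \/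
    #|Q t d :&: B| + #|Q t e :&: B| = 2.
  move=> de; have [_ I_ W_] := sideQ t.
  have := word_meet_block desD soD (W_ _ _ de) DB.
  rewrite setIUl cardsU setIACA I_ // set0I cards0 subn0; exact.
have k2 : #|Q (~~ s) k :&: B| = 2.
  by rewrite (setIidPl kB); have [-> _ _] := sideQ (~~ s).
have other : \sum_d #|Q (~~ s) d :&: B| = 2.
  rewrite (bigD1 k) //= k2 big1 // => d dk.
  by have [] := meet (~~ s) d k dk; rewrite k2; lia.
have : \sum_d #|Q s d :&: B| = 4.
  have := sum_columns B; rewrite cardD // big_bool /=.
  case: s other {kB k2} => /= other; lia.
rewrite sum_bool2.
have := meet s (false, false) (false, true) isT.
have := meet s (false, false) (true, false) isT.
have := meet s (false, false) (true, true) isT.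
have := meet s (false, true) (true, false) isT.
have := meet s (false, true) (true, true) isT.
have := meet s (true, false) (true, true) isT.
by case: c => [[] []]; lia.
Qed.

Lemma block_above_column s k : exists2 B, B \in D & Q s k \subset B.
Proof.
have [cQ _ _] := sideQ s; have [_ _ /(_ _ (cQ k)) c8] := desD.
have: 0 < #|[set b in D | Q s k \subset b]| by rewrite c8.
by case/card_gt0P=> B; rewrite inE => /andP[]; exists B.
Qed.

End TwoSides.

End Sides.

(** * The model design *)

Lemma card_count (T : finType) (s : seq T) (P : pred T) :
  uniq s -> (forall x, x \in s) -> #|[set x | P x]| = count P s.
Proof.
move=> us sT; rewrite cardsE cardE -size_filter.
apply/perm_size/uniq_perm; rewrite ?enum_uniq ?filter_uniq // => x.
by rewrite mem_enum mem_filter sT andbT.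
Qed.

Notation column := (bool * bool)%type.

(** (s, c, e): the point e of column c on side s. *)
Notation point := (bool * column * bool)%type.

(** (s, k, (a, u)): the whole column k on side ~~ s, and on side s the point
    a + u.c in each column c, where u.c is the dot product over F_2.  The affine
    functions of c are the bit vectors of even weight indexed by the four
    columns. *)
Notation block_index := (bool * column * (bool * (bool * bool)))%type.

Definition affine (au : bool * (bool * bool)) (c : column) : bool :=
  au.1 (+) (au.2.1 && c.1) (+) (au.2.2 && c.2).

Definition in_block (i : block_index) (p : point) : bool :=
  let: (s, k, au) := i in let: (t, c, e) := p in
  if s (+) t then ~~ (c.1 (+) k.1) && ~~ (c.2 (+) k.2) else ~~ (e (+) affine au c).

Definition model_block (i : block_index) : {set point} := [set p | in_block i p].

Definition model : {set {set point}} := [set model_block i | i : block_index].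

Definition bools := [:: false; true].
Definition columns : seq column := allpairs pair bools bools.
Definition points : seq point := allpairs pair (allpairs pair bools columns) bools.
Definition indices : seq block_index :=
  allpairs pair (allpairs pair bools columns) (allpairs pair bools columns).

Lemma mem_points p : p \in points. Proof. by case: p => [[[] [[] []]] []]. Qed.

Lemma mem_indices i : i \in indices.
Proof. by case: i => [[[] [[] []]] [[] [[] []]]]. Qed.

Lemma model_block_inj : injective model_block.
Proof.
pose differ i j := has (fun p => in_block i p (+) in_block j p) points.
have chk : all (fun i => all (fun j => (i == j) || differ i j) indices) indices.
  by vm_compute.
move=> i j /setP eij; apply/eqP.
have /allP/(_ j (mem_indices j)) := allP chk i (mem_indices i).
by case/orP=> // /hasP[p _]; have := eij p; rewrite !inE => ->; rewrite addbb.
Qed.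

Lemma card_model_block i : #|model_block i| = 6.
Proof.
have chk : all (fun i => count (in_block i) points == 6) indices by vm_compute.
by rewrite (card_count _ _ mem_points) //; apply/eqP/(allP chk)/mem_indices.
Qed.

Lemma model_design : is_design 2 16 6 8 model.
Proof.
split; first by rewrite !card_prod card_bool.
  by move=> _ /imsetP[i _ ->]; apply: card_model_block.
move=> A /eqP/cards2P[x [y [xy ->]]].
pose I := [set i | in_block i x && in_block i y].
have -> : [set b in model | [set x; y] \subset b] = model_block @: I.
  apply/setP=> b; rewrite inE subUset !sub1set.
  apply/andP/imsetP => [[/imsetP[i _ ->]]|[i Ii ->]].
    by rewrite !inE => bi; exists i; rewrite ?inE.
  by rewrite imset_f //; move: Ii; rewrite !inE.
rewrite (card_imset _ model_block_inj) (card_count _ _ mem_indices) //.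
have chk : all (fun x => all (fun y => (x == y) ||
    (count (fun i => in_block i x && in_block i y) indices == 8)) points) points.
  by vm_compute.
have /allP/(_ y (mem_points y)) := allP chk x (mem_points x).
by rewrite (negPf xy) => /eqP.
Qed.

Lemma model_self_orthogonal : self_orthogonal 6 model.
Proof.
have chk : all (fun i => all (fun j =>
    ~~ odd (count (fun p => in_block i p && in_block j p) points)) indices) indices.
  by vm_compute.
move=> _ _ /imsetP[i _ ->] /imsetP[j _ ->] _; apply: negbTE.
have -> : model_block i :&: model_block j = [set p | in_block i p && in_block j p].
  by apply/setP=> p; rewrite !inE.
rewrite (card_count _ _ mem_points) //.
exact: (allP (allP chk i (mem_indices i)) j (mem_indices j)).
Qed.

Definition base_block s : {set point} :=
  model_block (s, (false, false), (false, (false, false))).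

Definition model_word (s : bool) (c : column) : {set point} :=
  [set p | (p.1.1 == s) && ((p.1.2 == (false, false)) || (p.1.2 == c))].

Lemma card_model_word s c : c != (false, false) -> #|model_word s c| = 4.
Proof.
rewrite (card_count _ _ mem_points) //.
by move: s c => [] [[] []].
Qed.

(** Starting from base_block s, the word of the columns (false, false) and k on
    side ~~ s replaces the whole column (false, false) by k, and words on side s
    flip the bits in any even set of columns of that side. *)
Lemma model_generated (E : {set point} -> Prop) :
    (forall A B, E A -> E B -> E (symdiff A B)) ->
    (forall s, E (base_block s)) ->
    (forall s c, c != (false, false) -> E (model_word s c)) ->
  forall i, E (model_block i).
Proof.
move=> ED Eb Ew [[s k] au].
pose opt t c (on : bool) := if on then model_word t c else set0.
have E0 : E set0.
  rewrite (_ : set0 = symdiff (base_block s) (base_block s)); first exact: ED.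
  by apply/setP=> p; rewrite !inE addbb.
have Eo t c on : c != (false, false) -> E (opt t c on).
  by move=> c0; case: on; [apply: Ew | apply: E0].
have Ek : E (opt (~~ s) k (k != (false, false))).
  by have [_|k0] := eqVneq k (false, false); [apply: E0 | apply: Eo].
rewrite (_ : model_block _ = symdiff (base_block s)
    (symdiff (opt (~~ s) k (k != (false, false)))
    (symdiff (opt s (false, true) (affine au (false, true)))
    (symdiff (opt s (true, false) (affine au (true, false)))
             (opt s (true, true) (affine au (true, true))))))).
  by do ?apply: (ED) => //; apply: Eo.
have in_opt t c on p : (p \in opt t c on) = on && (p \in model_word t c).
  by case: on; rewrite ?inE.
apply/setP=> p; rewrite ![_ \in symdiff _ _]inE !in_opt !inE.
move: s k au p {Ek}.
by case=> [] [[] []] [[] [[] []]] [[[] [[] []]] []].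
Qed.

(** * Uniqueness *)

Section Uniqueness.

Variables (Y : finType) (D : {set {set Y}}).
Hypothesis desD : is_design 2 16 6 8 D.
Hypothesis soD : self_orthogonal 6 D.

Let cardY : #|Y| = 16. Proof. by case: desD. Qed.
Let cardD b : b \in D -> #|b| = 6. Proof. by case: desD => _ + _; apply. Qed.

(** Label the points of each column by membership in a chosen block that meets
    every column of that side once. *)
Lemma coordinates : exists f : point -> Y,
  [/\ injective f, forall s, f @: base_block s \in D
    & forall s c, c != (false, false) -> f @: model_word s c \in words4 D].
Proof.
have [Q [sideQ disjQ]] := two_sides desD soD; pose o := (false, false).
have /fin_all_exists2[R DR oR] s := block_above_column desD sideQ (~~ s) o.
have /fin_all_exists[f fP] (p : point) :
    exists y, y \in Q p.1.1 p.1.2 /\ (y \in R p.1.1) = ~~ p.2.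
  case: p => [[s c] e] /=.
  have c1 := block_transversal desD soD sideQ disjQ c (DR s) (oR s).
  have [c2 _ _] := sideQ s; have := cardsID (R s) (Q s c); rewrite c1 c2.
  case: e => /= cD.
    have /card_gt0P[y] : 0 < #|Q s c :\: R s| by lia.
    by rewrite inE => /andP[/negPf yR yc]; exists y.
  have /card_gt0P[y] : 0 < #|Q s c :&: R s| by rewrite c1.
  by rewrite inE => /andP[yc yR]; exists y.
have f_inj : injective f.
  move=> [[s c] e] [[t d] e'] eq_f.
  have [/= fc fR] := fP (s, c, e); have [/= fd fR'] := fP (t, d, e').
  rewrite eq_f in fc fR; have [eq_s eq_c] := columns_disjoint sideQ disjQ fc fd.
  by rewrite -eq_c -eq_s -[e]negbK -fR eq_s fR' negbK.
exists f; split=> // [s|s c co].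
  suff -> : f @: base_block s = R s by [].
  apply/eqP; rewrite eqEcard (card_imset _ f_inj) card_model_block (cardD (DR s)).
  rewrite andbT; apply/subsetP=> _ /imsetP[[[t c] e] + ->].
  have [/= fc fR] := fP (t, c, e); rewrite inE /=.
  case: (eqVneq t s) fc fR => [->|ts] fc fR.
    by rewrite addbb fR; case: c e {fc fR} => [] [] [] [].
  have ets : t = ~~ s by case: t s ts {fc fR} => [] [].
  rewrite ets in fc *; case: s {ts ets fR} (oR s) fc => /= /subsetP oRs fc co;
    by apply: oRs; case: c co fc => [] [] [].
have [cQ IQ WQ] := sideQ s.
suff -> : f @: model_word s c = Q s c :|: Q s o by apply: WQ.
have [_ _ /(_ _ _ co)/words4P[cW _]] := sideQ s.
apply/eqP; rewrite eqEcard (card_imset _ f_inj) card_model_word // cW.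
rewrite andbT; apply/subsetP=> _ /imsetP[[[t d] e] + ->].
have [/= fd _] := fP (t, d, e); rewrite inE /= => /andP[/eqP et].
by case/orP=> /eqP ed; rewrite et ed in fd *; rewrite !inE fd ?orbT.
Qed.

(** The condition that f maps a set to one orthogonal to all blocks of D is
    linear, so it holds for all model blocks as soon as it holds for generators;
    by maximality the images are blocks of D. *)
Lemma model_unique : isomorphic model D.
Proof.
have [f [f_inj fb fw]] := coordinates.
have [g fK gK] : bijective f.
  by apply: inj_card_bij => //; rewrite cardY !card_prod card_bool.
have f_sym A B : f @: symdiff A B = symdiff (f @: A) (f @: B).
  apply/setP=> y; rewrite -[y]gK mem_imset // [LHS]inE.
  by rewrite [in RHS]inE !(mem_imset _ _ f_inj).
have f_block i : f @: model_block i \in D.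
  apply: (block_maximal desD soD).
    by rewrite (card_imset _ f_inj) card_model_block.
  move: i; apply: (@model_generated (fun A => {in D, forall b, orth (f @: A) b})).
  - move=> A B oA oB b Db; rewrite f_sym.
    by apply: orth_symdiff; [apply: oA | apply: oB].
  - by move=> s b Db; apply: (orth_blocks desD soD).
  - by move=> s c c0; have [_] := words4P _ _ (fw s c c0).
exists f; first by exists g.
apply/eqP; rewrite eqEcard (card_imset _ (imset_inj f_inj)).
rewrite (card_blocks desD) (card_blocks model_design) leqnn andbT.
by apply/subsetP=> _ /imsetP[_ /imsetP[i _ ->] ->].
Qed.

End Uniqueness.

(** * The code of the design *)

Section Code.

Variables (T : finType) (D : {set {set T}}).
Hypothesis desD : is_design 2 16 6 8 D.
Hypothesis soD : self_orthogonal 6 D.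

Let cardT : #|T| = 16. Proof. by case: desD. Qed.
Let cardD b : b \in D -> #|b| = 6. Proof. by case: desD => _ + _; apply. Qed.

Lemma row_incidence i : row i (incidence_mx D) = char_vec (enum_val i).
Proof. by apply/rowP=> j; rewrite !mxE. Qed.

Lemma block_in_code b : b \in D -> char_vec b \in design_code D.
Proof.
move=> Db; apply: memv_span; apply/imageP.
by exists (enum_rank_in Db b); rewrite // row_incidence enum_rankK_in.
Qed.

Lemma dot_design_code (A : {set T}) : {in D, forall b, orth A b} ->
  forall x, x \in design_code D -> dot x (char_vec A) = 0%R.
Proof.
move=> oA; apply: dot_span => _ /imageP[i _ ->].
by rewrite row_incidence; apply/dot_char_vec0; rewrite orthC oA // enum_valP.
Qed.

Lemma design_code_orth : {in design_code D &, forall x y, dot x y = 0%R}.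
Proof.
apply: dot_span2 => _ _ /imageP[i _ ->] /imageP[j _ ->].
rewrite !row_incidence.
by apply/dot_char_vec0/(orth_blocks desD soD); apply: enum_valP.
Qed.

Lemma design_code_setP (A : {set T}) : char_vec A \in design_code D ->
  {in D, forall b, orth A b} /\ orth A A.
Proof.
move=> CA; split=> [b Db|]; apply/dot_char_vec0/design_code_orth => //.
exact: block_in_code.
Qed.

Hypothesis allone : char_vec [set: T] \in design_code D.

Lemma dim_design_code : \dim (design_code D) = 8.
Proof.
apply/eqP; rewrite eqn_leq; apply/andP; split.
  rewrite -(leq_pmul2l (isT : 0 < 2)).
  by apply: leq_trans (dim_self_orthogonal design_code_orth) _; rewrite cardT.
rewrite -(leq_exp2l 8 _ (isT : 1 < 2)) -card_code.
have := leq_card_orth_family cardT cardD (orth_blocks desD soD) allone block_in_code.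
by rewrite (card_blocks desD).
Qed.

(** A word orthogonal to the code is orthogonal to the all-one word, hence to
    itself; adding it to the code keeps the code self-orthogonal, and no
    self-orthogonal code has dimension above 8. *)
Lemma design_code_self_dual : self_dual (design_code D).
Proof.
move=> x; split=> [Cx y Cy|ox]; first exact: design_code_orth.
have oxx : dot x x = 0%R.
  by have := ox _ allone; rewrite -[x]supportK !dot_char_vec setIT setIid.
pose U := (design_code D + <[x]>)%VS.
have orthU : {in U &, forall u v, dot u v = 0%R}.
  move=> _ _ /memv_addP[c Cc [_ /vlineP[a ->] ->]]
    /memv_addP[d Cd [_ /vlineP[b ->] ->]].
  rewrite dotDl dotZl ![dot _ (d + _)%R]dotC !dotDl !dotZl.
  by rewrite (design_code_orth Cd Cc) (ox c) // (dotC d x) (ox d) //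
    oxx !(mulr0, addr0).
have dimU : \dim U <= \dim (design_code D).
  rewrite dim_design_code -(leq_pmul2l (isT : 0 < 2)).
  by apply: leq_trans (dim_self_orthogonal orthU) _; rewrite cardT.
have /eqP -> : design_code D == U by rewrite eqEdim addvSl.
by apply: (subvP (addvSr _ _)); apply: memv_line.
Qed.

(** All words of the code have even weight, and weight 2 is excluded because
    the word would be orthogonal to all blocks. *)
Lemma design_code_weight (A : {set T}) :
  char_vec A \in design_code D -> A != set0 -> 4 <= #|A|.
Proof.
move=> /design_code_setP[oA oAA]; rewrite -card_gt0.
have := no_orth_pair desD oA; move: oAA; rewrite /orth setIid.
by move: #|A| => [|[|[|[|]]]].
Qed.

Lemma design_code_min_dist : is_min_dist (design_code D) 4.
Proof.
split.
  have [x _] : exists x : T, x \in [set: T].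
    by apply/card_gt0P; rewrite cardsT cardT.
  have : 0 < #|star (words4 D) x| by rewrite card_star_words.
  case/card_gt0P=> w; rewrite inE => /andP[/words4P[cw ow] _].
  have Cw : char_vec w \in design_code D.
    by apply/design_code_self_dual => y Cy; rewrite dotC dot_design_code.
  exists (char_vec w), (char_vec set0).
  have sym0 : symdiff w set0 = w by apply/setP=> z; rewrite !inE addbF.
  rewrite hamming_char_vec sym0 Cw cw; split=> //.
    rewrite (_ : char_vec set0 = 0)%R ?mem0v //.
    by apply/rowP=> j; rewrite !mxE inE.
  by apply/eqP=> /(can_inj (@char_vecK T)) w0; rewrite w0 cards0 in cw.
move=> x y; rewrite -[x]supportK -[y]supportK => Cx Cy xy.
rewrite hamming_char_vec; apply: design_code_weight.
  by rewrite char_vec_symdiff memvD.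
apply: contraNneq xy => s0; apply/eqP; congr char_vec; apply/setP=> z.
by have /setP/(_ z) := s0; rewrite !inE; case: (_ != _); case: (_ != _).
Qed.

Lemma design_code_typeI : typeI (design_code D).
Proof.
split=> [|de]; first exact: design_code_self_dual.
have [x _] : exists x : T, x \in [set: T].
  by apply/card_gt0P; rewrite cardsT cardT.
have [b Db _] := block_through desD x.
by have := de _ (block_in_code Db); rewrite weight_char_vec cardD.
Qed.

End Code.

(** The four blocks have their whole columns in the first two columns of both
    sides, while their remaining points cancel in those columns and fill the last
    two. *)
Lemma allone_in_model_code : char_vec [set: point] \in design_code model.
Proof.
pose z : bool * (bool * bool) := (false, (false, false)).
pose h : bool * (bool * bool) := (false, (true, false)).
have -> : [set: point] =
    symdiff (symdiff (model_block (true, (false, false), z))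
                     (model_block (true, (false, true), h)))
            (symdiff (model_block (false, (false, false), z))
                     (model_block (false, (false, true), h))).
  by apply/setP=> -[[[] [[] []]] []]; rewrite !inE.
by rewrite !char_vec_symdiff !memvD // block_in_code // imset_f.
Qed.

Theorem theorem1p3 :
  exists (X : finType) (D : {set {set X}}),
    [/\ is_design 2 16 6 8 D,
        self_orthogonal 6 D,
        (forall (Y : finType) (D' : {set {set Y}}),
           is_design 2 16 6 8 D' -> self_orthogonal 6 D' -> isomorphic D D'),
        near_extremal (design_code D)
      & is_code (design_code D) 16 8 4].
Proof.
have [desM soM] := (model_design, model_self_orthogonal).
have allM := allone_in_model_code.
have dist4 := design_code_min_dist desM soM allM.
exists point, model; split=> //.
- by move=> Y D' desD' soD'; apply: model_unique.
- split; first exact: design_code_typeI.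
  by rewrite (_ : 2 * (_ %/ 8) = 4) // !card_prod card_bool.
- by split=> //; [rewrite !card_prod card_bool | apply: dim_design_code].
Qed.
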